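(* $\alpha_2=24/7$.
   Context: $\mathsf{3\text{-}MAJ}_k:\{0,1\}^{3^k}\to\{0,1\}$ is recursive majority-of-three on the complete ternary tree $T_k$ (leaves $1,\dots,3^k$ left to right; $\mathsf{3\text{-}MAJ}_0$ is the identity). Hard inputs: $\mathcal{H}_0=\{0,1\}$; for $h>0$, $\mathcal{H}_h$ is the set of $(x,y,z)\in\mathcal{H}_{h-1}^3$ with $\mathsf{3\text{-}MAJ}_{h-1}(x),\mathsf{3\text{-}MAJ}_{h-1}(y),\mathsf{3\text{-}MAJ}_{h-1}(z)$ not all equal; $\mathcal{H}^0_h=\{x\in\mathcal{H}_h:\mathsf{3\text{-}MAJ}_h(x)=0\}$. For $x\in\mathcal{H}_h$, the minority path starts at the root and repeatedly goes to the child whose value differs from its parent's; its leaf is the absolute minority $m(x)$. Encoding: let $\mathcal{R}=\{0,1\}\times\{1,2,3\}$ and $c(y,(b,1))=(y,b,1-b)$, $c(y,(b,2))=(1-b,y,b)$, $c(y,(b,3))=(b,1-b,y)$. Let $\mathcal{R}^{(1)}_h=\mathcal{R}^{3^{h-1}}$, $\mathcal{R}^{(k)}_h=\mathcal{R}^{(k-1)}_h\times\mathcal{R}^{3^{h-k}}$. For $y\in\mathcal{H}_{h-1}$, $r\in\mathcal{R}^{(1)}_h$, $\psi^{(1)}(y,r)=x$ with $(x_{3i-2},x_{3i-1},x_{3i})=c(y_i,r_i)$; for $k>1$, $y\in\mathcal{H}_{h-k}$, $(R,r)\in\mathcal{R}^{(k)}_h$: $\psi^{(k)}(y,(R,r))=\psi^{(k-1)}(\psi^{(1)}(y,r),R)$.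 With $\psi=\psi^{(k)}:\{0,1\}\times\mathcal{R}^{(k)}_k\to\mathcal{H}_k$, let $q_1(r)$ be the unique index with $\psi(y,r)_{q_1(r)}=y$ for both $y\in\{0,1\}$. For a deterministic decision tree $C$ on $3^k$ variables querying at least one variable, \[ \alpha_C=\frac{\Pr_{x\in_R\mathcal{H}^0_k,\ (y,r)\in_R\psi^{-1}(x)}[C(x)\text{ queries }x_{q_1(r)}]}{\Pr_{x\in_R\mathcal{H}^0_k}[C(x)\text{ queries }x_{m(x)}]}, \] and $\alpha_k=\max_C\alpha_C$ over all such $C$. Here $k=2$. *)

(* Defs.v *)
From HB Require Import structures.
From mathcomp Require Import all_boot all_order all_algebra.

Set Implicit Arguments.
Unset Strict Implicit.
Unset Printing Implicit Defensive.

Import Order.TTheory GRing.Theory Num.Theory.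

(* Leaves are numbered from 0, so leaf i of T_k is 'I_(3 ^ k) of value i - 1;
   likewise {1,2,3} is represented by 'I_3. *)
Definition input (k : nat) : finType := {ffun 'I_(3 ^ k) -> bool}.

Lemma leaf_subproof k (j : 'I_3) (i : 'I_(3 ^ k)) : j * 3 ^ k + i < 3 ^ k.+1.
Proof.
rewrite expnS; apply: leq_trans (_ : j.+1 * 3 ^ k <= _).
  by rewrite mulSn addnC ltn_add2r.
by rewrite leq_mul2r ltn_ord orbT.
Qed.

Definition leaf k (j : 'I_3) (i : 'I_(3 ^ k)) : 'I_(3 ^ k.+1) :=
  Ordinal (leaf_subproof j i).

Definition child k (x : input k.+1) (j : 'I_3) : input k :=
  [ffun i => x (leaf j i)].

Fixpoint maj3 (k : nat) : input k -> bool :=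
  match k return input k -> bool with
  | 0 => fun x => x ord0
  | k'.+1 => fun x => 1 < \sum_(j < 3) maj3 (child x j)
  end.

Fixpoint hard (k : nat) : input k -> bool :=
  match k return input k -> bool with
  | 0 => fun _ => true
  | k'.+1 => fun x =>
      [forall j, hard (child x j)] &&
      [exists i, exists j, maj3 (child x i) != maj3 (child x j)]
  end.

Definition hard0 (k : nat) : {set input k} :=
  [set x | hard x & ~~ maj3 x].

(* On hard inputs exactly one child disagrees with its parent; the default
   value ord0 is only reached outside the set of hard inputs. *)
Fixpoint abs_min (k : nat) : input k -> 'I_(3 ^ k) :=
  match k return input k -> 'I_(3 ^ k) with
  | 0 => fun _ => ord0
  | k'.+1 => fun x =>
      let j := odflt ord0 [pick j | maj3 (child x j) != maj3 x] in
      leaf j (abs_min (child x j))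
  end.

Definition enc3 (y : bool) (s : bool * 'I_3) : 3.-tuple bool :=
  let b := s.1 in
  match val s.2 with
  | 0 => [tuple y; b; ~~ b]
  | 1 => [tuple ~~ b; y; b]
  | _ => [tuple b; ~~ b; y]
  end.

Lemma parent_subproof m (l : 'I_(3 ^ m.+1)) : l %/ 3 < 3 ^ m.
Proof. by rewrite ltn_divLR // -expnSr. Qed.

Definition parent m (l : 'I_(3 ^ m.+1)) : 'I_(3 ^ m) :=
  Ordinal (parent_subproof l).

Definition digit m (l : 'I_(3 ^ m.+1)) : 'I_3 :=
  Ordinal (ltn_pmod l (isT : 0 < 3)).

Definition psi1 m (y : input m) (r : {ffun 'I_(3 ^ m) -> bool * 'I_3}) :
    input m.+1 :=
  [ffun l => tnth (enc3 (y (parent l)) (r (parent l))) (digit l)].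

(* [noise k m] is R^(k)_h with h = k + m. The recursion starts at k = 0 with a
   one-point set and the identity as encoding, so that R^(1)_h is
   unit * R^(3^(h-1)). *)
Fixpoint noise (k m : nat) : finType :=
  if k is k'.+1 then
    (noise k' m.+1 * {ffun 'I_(3 ^ m) -> bool * 'I_3})%type
  else unit.

(* [NatTrec.add k m] is k + m, computed so that no cast is needed here. *)
Fixpoint psi (k m : nat) {struct k} :
    input m -> noise k m -> input (NatTrec.add k m) :=
  match k return input m -> noise k m -> input (NatTrec.add k m) with
  | 0 => fun y _ => y
  | k'.+1 => fun y Rr => @psi k' m.+1 (psi1 y Rr.2) Rr.1
  end.

Lemma height_root k : 3 ^ k = 3 ^ NatTrec.add k 0.
Proof. by rewrite NatTrec.addE addn0. Qed.

Definition psi_root k (y : bool) (r : noise k 0) : input k :=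
  [ffun i => @psi k 0 [ffun=> y] r (cast_ord (height_root k) i)].

Lemma leaf0_subproof k : 0 < 3 ^ k.
Proof. by rewrite expn_gt0. Qed.

(* The index picked exists and is unique, see [q1P] below. *)
Definition q1 k (r : noise k 0) : 'I_(3 ^ k) :=
  odflt (Ordinal (leaf0_subproof k))
        [pick i | [forall y : bool, psi_root y r i == y]].

Inductive dtree (n : nat) : Type :=
| Answer (b : bool)
| Query (i : 'I_n) (t0 t1 : dtree n).

Fixpoint queries n (C : dtree n) (x : {ffun 'I_n -> bool}) : seq 'I_n :=
  match C with
  | Answer _ => [::]
  | Query i t0 t1 => i :: queries (if x i then t1 else t0) x
  end.

Definition querying n (C : dtree n) : bool :=
  if C is Query _ _ _ then true else false.

Local Open Scope ring_scope.

Definition avg (T : finType) (A : {set T}) (f : T -> rat) : rat :=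
  (\sum_(x in A) f x) / #|A|%:R.

Definition Pr (T : finType) (A : {set T}) (E : pred T) : rat :=
  avg A (fun x => (E x)%:R).

Definition psi_fiber k (x : input k) : {set bool * noise k 0} :=
  [set u | psi_root u.1 u.2 == x].

Definition alpha_tree k (C : dtree (3 ^ k)) : rat :=
  avg (hard0 k) (fun x => Pr (psi_fiber x) (fun u => q1 u.2 \in queries C x))
  / Pr (hard0 k) (fun x => abs_min x \in queries C x).

(* alpha_k = a, where alpha_k is the maximum of alpha_tree. *)
Definition is_alpha (k : nat) (a : rat) : Prop :=
  (exists2 C : dtree (3 ^ k), querying C & alpha_tree C = a) /\
  (forall C : dtree (3 ^ k), querying C -> alpha_tree C <= a).

Local Close Scope ring_scope.

(* If two inputs of height m differ exactly at leaf j, then so do their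
   encodings at some leaf i, which carries the value of leaf j. *)
Lemma psi_sensitive k m (y z : input m) (r : noise k m) (j : 'I_(3 ^ m)) :
    (forall l, (y l != z l) = (l == j)) ->
  exists i, [/\ forall l, (psi y r l != psi z r l) = (l == i),
                psi y r i = y j & psi z r i = z j].
Proof.
elim: k m y z r j => [|k IHk] m y z r j yz /=; first by exists j.
case: r => R r /=.
pose s := r j.
have ltl : 3 * j + s.2 < 3 ^ m.+1.
  rewrite expnS; apply: leq_trans (_ : 3 * j.+1 <= _).
    by rewrite mulnSr ltn_add2l.
  by rewrite leq_mul2l ltn_ord.
pose l0 : 'I_(3 ^ m.+1) := Ordinal ltl.
have pl0 : parent l0 = j.
  by apply: val_inj; rewrite /= mulnC divnMDl // divn_small ?addn0.
have dl0 : digit l0 = s.2.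
  by apply: val_inj; rewrite /= mulnC modnMDl modn_small.
have encE b t : tnth (enc3 b t) t.2 = b.
  by case: t => [c [[|[|[|?]]] ?]] //=; case: b; case: c.
have encN b u t : t != u.2 -> tnth (enc3 b u) t = tnth (enc3 (~~ b) u) t.
  by case: u t => [c [[|[|[|?]]] ?]] [[|[|[|?]]] ?].
have e1 : psi1 y r l0 = y j by rewrite ffunE pl0 dl0 encE.
have e2 : psi1 z r l0 = z j by rewrite ffunE pl0 dl0 encE.
have D l : (psi1 y r l != psi1 z r l) = (l == l0).
  have [->|nl] := eqVneq l l0; first by rewrite e1 e2 yz eqxx.
  rewrite !ffunE; apply/negbTE; rewrite negbK.
  have := yz (parent l); have [pl|_] := eqVneq (parent l) j; last first.
    by move/negbFE/eqP->.
  rewrite pl => yzj; have -> : z j = ~~ y j by case: (y j) (z j) yzj => [] [].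
  apply/eqP/encN; apply: contraNneq nl => dl; apply/eqP/val_inj => /=.
  rewrite (divn_eq l 3) mulnC -/s -dl /=; congr (3 * _ + _).
  by rewrite -pl.
have [i [Hi yi zi]] := IHk _ _ _ R l0 D.
by exists i; rewrite yi zi e1 e2.
Qed.

Lemma q1P k (r : noise k 0) :
  (forall y, psi_root y r (q1 r) = y) /\
  (forall i, (forall y, psi_root y r i = y) -> i = q1 r).
Proof.
have D (l : 'I_(3 ^ 0)) : (([ffun=> false] : input 0) l
    != ([ffun=> true] : input 0) l) = (l == ord0).
  by rewrite !ffunE [l]ord1.
have [i [Hi fi ti]] := psi_sensitive r D.
pose i' := cast_ord (esym (height_root k)) i.
have Hi' y : psi_root y r i' = y.
  by rewrite ffunE cast_ordKV; case: y; rewrite ?fi ?ti ffunE.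
have U l : (forall y, psi_root y r l = y) -> l = i'.
  move=> Hl; have := Hi (cast_ord (height_root k) l).
  have := Hl false; rewrite ffunE => ->; have := Hl true; rewrite ffunE => ->.
  by move=> /esym/eqP E; rewrite /i' -E cast_ordK.
have -> : q1 r = i'.
  rewrite /q1; case: pickP => [l /forallP Hl|/(_ i')] /=.
    by apply: U => y; apply/eqP.
  by move/negbT/forallP => []; move=> y; rewrite Hi'.
by split.
Qed.

(* Main.v *)
Require Import Defs.
From mathcomp Require Import all_boot all_order all_algebra.
From mathcomp Require Import zify.
Import Order.TTheory GRing.Theory Num.Theory.
Local Open Scope ring_scope.

(* For x in H_2 of value 0, the 16 points of the fiber over x are shared equally
   by the four leaves of value 0 in the two children of value 0, the absolute
   majority leaves, so alpha_C = A / (4 B), where A and B count the pairs of an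
   input x and an absolute majority, resp. minority, leaf queried by C(x).
   To see that 7 A <= 96 B, let C start from any partial assignment and count
   only the inputs that agree with it and the leaves not yet read. Then 7 A is
   at most 96 B plus a potential that depends only on the numbers of 0s and 1s
   read in each child and vanishes at the empty assignment; by induction on C it
   suffices to check this for a single query, which is a finite computation. A
   tree with A = 192 and B = 14 attains the bound. *)

Set Implicit Arguments.
Unset Strict Implicit.
Unset Printing Implicit Defensive.

Local Open Scope nat_scope.

(** * Three-element index sets and leaf coordinates *)

Definition o0 : 'I_3 := Ordinal (isT : 0 < 3).
Definition o1 : 'I_3 := Ordinal (isT : 1 < 3).
Definition o2 : 'I_3 := Ordinal (isT : 2 < 3).

Lemma ord3P (j : 'I_3) : [\/ j = o0, j = o1 | j = o2].
Proof.
by case: j => [[|[|[|?]]] ?] //; [apply: Or31|apply: Or32|apply: Or33];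
  apply: val_inj.
Qed.

Lemma big_ord3 (R : Type) (idx : R) (op : R -> R -> R) (F : 'I_3 -> R) :
  \big[op/idx]_(j < 3) F j = op (F o0) (op (F o1) (op (F o2) idx)).
Proof.
rewrite !big_ord_recl big_ord0.
by do !congr (op (F _) _); apply: val_inj.
Qed.

Lemma sum_ord3 (F : 'I_3 -> nat) : \sum_(j < 3) F j = F o0 + (F o1 + F o2).
Proof. by rewrite big_ord3 /= addn0. Qed.

Lemma prod_ord3 (F : 'I_3 -> nat) : \prod_(j < 3) F j = F o0 * (F o1 * F o2).
Proof. by rewrite big_ord3 /= muln1. Qed.

Lemma forall_ord3 (P : pred 'I_3) :
  [forall j, P j] = [&& P o0, P o1 & P o2].
Proof.
apply/forallP/and3P => [H|[P0 P1 P2] j]; first by split.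
by case: (ord3P j) => ->.
Qed.

Lemma exists_ord3 (P : pred 'I_3) :
  [exists j, P j] = [|| P o0, P o1 | P o2].
Proof. by apply: negb_inj; rewrite negb_exists forall_ord3 !negb_or. Qed.

Lemma leaf_inj k j j' (i i' : 'I_(3 ^ k)) :
  leaf j i = leaf j' i' -> j = j' /\ i = i'.
Proof.
move=> /(congr1 val) /= E; have k0 : 0 < 3 ^ k by rewrite expn_gt0.
have := congr1 (divn^~ (3 ^ k)) E; have := congr1 (modn^~ (3 ^ k)) E.
rewrite !modnMDl !divnMDl // !modn_small // !divn_small // !addn0.
by move=> /val_inj -> /val_inj ->.
Qed.

Lemma leaf1 (j : 'I_3) (i : 'I_(3 ^ 0)) : leaf j i = j.
Proof. by apply: val_inj; rewrite [i]ord1 /= muln1 addn0. Qed.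

Lemma leafP (l : 'I_(3 ^ 2)) : leaf (parent l) (digit l : 'I_(3 ^ 1)) = l.
Proof. by apply: val_inj; rewrite /= -divn_eq. Qed.

Lemma parent_leaf (j : 'I_3) (q : 'I_(3 ^ 1)) : parent (leaf j q) = j.
Proof.
apply: val_inj; apply: (etrans (divnMDl j q (isT : 0 < 3))).
by rewrite divn_small ?addn0.
Qed.

Lemma digit_leaf (j : 'I_3) (q : 'I_(3 ^ 1)) : digit (leaf j q) = q.
Proof.
by apply: val_inj; apply: (etrans (modnMDl j q 3)); rewrite modn_small.
Qed.

Lemma leaf_eqE k j j' (i i' : 'I_(3 ^ k)) :
  (leaf j i == leaf j' i') = (j == j') && (i == i').
Proof.
apply/eqP/andP => [/leaf_inj [-> ->]|[/eqP -> /eqP ->]] //.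
Qed.

(** * Majority and hardness read off the values of the root's children *)

Definition top k (x : input k.+1) : input 1 := [ffun j => maj3 (child x j)].

Lemma top_bit k (x : input k.+1) j : top x j = maj3 (child x j).
Proof. by rewrite ffunE. Qed.

Lemma maj3_leaf1 (t : input 1) j : maj3 (child t j) = t j.
Proof. by rewrite /= ffunE leaf1. Qed.

Lemma maj3_top k (x : input k.+1) : maj3 x = maj3 (top x).
Proof.
rewrite [LHS]/= [RHS]/=; congr (1 < _).
by apply: eq_bigr => j _; rewrite !ffunE leaf1.
Qed.

(** The children of the root form an input of height 1, so the facts on three bits below serve both
    at the root and at each child. *)
Lemma hard_top k (x : input k.+1) :
  hard x = [forall j, hard (child x j)] && hard (top x).
Proof.
rewrite [LHS]/= [in RHS]/=; congr (_ && _).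
have -> : [forall j : 'I_3, true] by apply/forallP.
apply: eq_existsb => i; apply: eq_existsb => j.
by rewrite !ffunE !leaf1.
Qed.

Lemma maj3_bits (t : input 1) : maj3 t = (1 < t o0 + t o1 + t o2).
Proof. by rewrite /= big_ord3 !ffunE !leaf1 addn0 addnA. Qed.

Lemma hard_bits (t : input 1) : hard t = ~~ ((t o0 == t o1) && (t o1 == t o2)).
Proof.
rewrite /= forall_ord3 /= !exists_ord3 !ffunE !leaf1.
by case: (t o0) (t o1) (t o2) => [] [] [].
Qed.

(** * Fibers of the encoding *)

Notation enc_bit := (bool * 'I_3)%type.

Definition fits (t : input 1) (y : bool) (s : enc_bit) : bool :=
  [forall q, tnth (enc3 y s) q == t q].

Lemma sum_noise (F : enc_bit -> nat) :
  \sum_s F s = \sum_(j < 3) (F (false, j) + F (true, j)).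
Proof.
rewrite (eq_bigr (fun s => F (s.1, s.2))); last by case.
rewrite -(pair_big xpredT xpredT (fun b j => F (b, j))) /= exchange_big /=.
by apply: eq_bigr => j _; rewrite big_bool addnC.
Qed.

(** The two positions other than [q] must hold unequal bits. If they do, the remaining bit is the
    majority, and one of them fixes the bit of [s]. *)
Lemma fits_at (t : input 1) y q : hard t ->
  \sum_(s : enc_bit) (fits t y s && (s.2 == q)) =
     (maj3 t == y) && (t q == y).
Proof.
rewrite hard_bits maj3_bits sum_noise big_ord3 /fits !forall_ord3 !(tnth_nth false) /=.
by case: (ord3P q) => -> /=; case: (t o0) (t o1) (t o2) y => [] [] [] [].
Qed.

Lemma fits_card (t : input 1) y : hard t ->
  \sum_(s : enc_bit) fits t y s = 2 * (maj3 t == y).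
Proof.
rewrite hard_bits maj3_bits sum_noise big_ord3 /fits !forall_ord3 !(tnth_nth false) /=.
by case: (t o0) (t o1) (t o2) y => [] [] [] [].
Qed.

(** In [noise 2 0] the last component [r.2] is the symbol at the root, and [r.1.2] holds the symbols
    of its three children. *)
Lemma psi_root_leaf (y : bool) (r : noise 2 0) (j : 'I_3) (q : 'I_(3 ^ 1)) :
  psi_root y r (leaf j q)
    = tnth (enc3 (tnth (enc3 y (r.2 ord0)) j) (r.1.2 j)) q.
Proof.
rewrite ffunE.
have -> : cast_ord (height_root 2) (leaf j q) = leaf j q by apply: val_inj.
rewrite /psi ffunE parent_leaf digit_leaf ffunE.
have -> : parent (j : 'I_(3 ^ 1)) = ord0 by apply: ord1.
have -> : digit (j : 'I_(3 ^ 1)) = j by apply: val_inj; rewrite /= modn_small.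
by rewrite ffunE.
Qed.

Lemma enc3_id y (s : enc_bit) : tnth (enc3 y s) s.2 = y.
Proof. by case: s => b j; case: (ord3P j) => ->; case: y. Qed.

Lemma q1_leaf (r : noise 2 0) :
  q1 r = leaf (r.2 ord0).2 ((r.1.2 (r.2 ord0).2).2 : 'I_(3 ^ 1)).
Proof.
by apply/esym/(q1P r).2 => y; rewrite psi_root_leaf !enc3_id.
Qed.

Lemma psi_root_fits (y : bool) (r : noise 2 0) (x : input 2) :
  (psi_root y r == x)
    = [forall j, fits (child x j) (tnth (enc3 y (r.2 ord0)) j) (r.1.2 j)].
Proof.
apply/eqP/forallP => [<- j|H].
  by apply/forallP => q; rewrite ffunE psi_root_leaf.
apply/ffunP => l; rewrite -(leafP l) psi_root_leaf.
by have /forallP/(_ (digit l))/eqP-> := H (parent l); rewrite ffunE.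
Qed.

Lemma sum_fiber (F : bool -> enc_bit -> {ffun 'I_3 -> enc_bit} -> nat) :
  \sum_(u : bool * noise 2 0) F u.1 (u.2.2 ord0) u.2.1.2
    = \sum_(y : bool) \sum_(s : enc_bit) \sum_R F y s R.
Proof.
pose h (w : bool * (enc_bit * {ffun 'I_3 -> enc_bit})) : bool * noise 2 0 :=
  (w.1, ((tt, w.2.2), [ffun => w.2.1])).
pose h' (u : bool * noise 2 0) := (u.1, (u.2.2 ord0, u.2.1.2)).
rewrite (reindex h) /=; last first.
  exists h' => [[y [s R]] _|[y [[[] R] s]] _]; rewrite /h /h' /= ?ffunE //.
  by congr (_, (_, _)); apply/ffunP => i; rewrite ffunE (ord1 i).
rewrite (eq_bigr (fun w => F w.1 w.2.1 w.2.2)); last first.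
  by move=> w _; rewrite ffunE.
rewrite -(pair_big xpredT xpredT (fun y w => F y w.1 w.2)) /=.
apply: eq_bigr => y _.
by rewrite -(pair_big xpredT xpredT (fun s R => F y s R)).
Qed.

(* Leaf [l] is queried with answer 0; on inputs of value 0 it is an absolute
   majority leaf if [v = false], and the absolute minority if [v = true]. *)
Definition target (v : bool) (x : input 2) (l : 'I_(3 ^ 2)) : bool :=
  ~~ x l && (maj3 (child x (parent l)) == v).

(** The encoded bit must be 0. One root symbol fits [top x] and sends the bit to the child of [l],
    one symbol there sends it on to [l], and each of the two other children admits 2 symbols. *)
Lemma fiber_at (x : input 2) (l : 'I_(3 ^ 2)) : x \in hard0 2 ->
  \sum_(u in psi_fiber x) (q1 u.2 == l) = 4 * target false x l.
Proof.
rewrite inE hard_top maj3_top => /andP[/andP[/forallP hx ht] m0].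
set j := parent l; set q : 'I_(3 ^ 1) := digit l.
pose F (y : bool) (s : enc_bit) (R : {ffun 'I_3 -> enc_bit}) : nat :=
  [forall i, fits (child x i) (tnth (enc3 y s) i) (R i)]
  && ((s.2 == j) && ((R s.2).2 == q)).
rewrite big_mkcond /= (eq_bigr (fun u : bool * noise 2 0 =>
    F u.1 (u.2.2 ord0) u.2.1.2)); last first.
  move=> [y r] _; rewrite inE psi_root_fits q1_leaf -[in LHS](leafP l) leaf_eqE /F /=.
  by case: ifP.
rewrite sum_fiber.
(* The requirement on [q] is charged to the factor of child [j] alone, so that the sum over [R]
   becomes a product over the children. *)
pose G i y (s : enc_bit) : nat :=
  fits (child x i) y s && ((i == j) ==> (s.2 == q)).
have GE i y : \sum_s G i y s
    = (maj3 (child x i) == y) * (if i == j then x l == y : nat else 2).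
  rewrite /G; case: eqP => [->|_] /=.
    rewrite fits_at // mulnb; congr (nat_of_bool (_ && (_ == _))).
    by rewrite ffunE leafP.
  by rewrite mulnC -fits_card //; apply: eq_bigr => s _; rewrite andbT.
have FE y s : \sum_R F y s R
    = ((fits (top x) y s && (s.2 == j)) && (x l == top x j)) * 4.
  have [sj|sj] := eqVneq s.2 j; last first.
    by rewrite andbF big1 // => R _; rewrite /F (negPf sj) andbF.
  transitivity (\sum_(R : {ffun 'I_3 -> enc_bit})
      \prod_i G i (tnth (enc3 y s) i) (R i)).
    apply: eq_bigr => R _; rewrite /F sj eqxx big_ord3 forall_ord3 /G /= muln1 !mulnb.
    move: (fits _ _ (R o0)) (fits _ _ (R o1)) (fits _ _ (R o2)) => a b c.
    by case: (ord3P j) => -> /=; case: a b c => [] [] []; rewrite ?andbT ?andbF.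
  rewrite -[LHS](bigA_distr_bigA (fun i t => G i (tnth (enc3 y s) i) t)).
  rewrite (eq_bigr _ (fun i _ => GE i (tnth (enc3 y s) i))) andbT.
  rewrite /fits forall_ord3 big_ord3 !ffunE.
  move: (tnth _ o0) (tnth _ o1) (tnth _ o2) => a0 a1 a2.
  case: (ord3P j) => ->;
    move: (maj3 (child x o0)) (maj3 (child x o1)) (maj3 (child x o2));
    by move=> [] [] [] /=; case: a0 a1 a2 (x l) => [] [] [] [].
rewrite (eq_bigr (fun y : bool =>
    (maj3 (top x) == y) && (top x j == y) * ((x l == top x j) * 4))); last first.
  move=> y _; rewrite -fits_at // big_distrl /=; apply: eq_bigr => s _.
  by rewrite FE -!mulnb mulnA.
rewrite big_bool (negPf m0) /= /target ffunE -/j.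
by case: (x l) (maj3 (child x j)) => [] [].
Qed.

Lemma sum_leaf (F : 'I_(3 ^ 2) -> nat) :
  \sum_l F l = \sum_(j < 3) \sum_(q < 3 ^ 1) F (leaf j q).
Proof.
rewrite pair_big /=; apply: reindex.
exists (fun l => (parent l, digit l)) => [[j q] _|l _]; last exact: leafP.
by rewrite parent_leaf digit_leaf.
Qed.

Lemma fiber_sum (x : input 2) (P : pred 'I_(3 ^ 2)) : x \in hard0 2 ->
  \sum_(u in psi_fiber x) P (@q1 2 u.2) = 4 * \sum_l (P l && target false x l).
Proof.
move=> hx; rewrite big_distrr /=.
transitivity (\sum_(u in psi_fiber x) \sum_l (P l && (@q1 2 u.2 == l) : nat)).
  apply: eq_bigr => u _; rewrite (bigD1 (@q1 2 u.2)) //= eqxx andbT big1 ?addn0 //.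
  by move=> l; rewrite eq_sym => /negPf ->; rewrite andbF.
rewrite exchange_big /=; apply: eq_bigr => l _.
rewrite -mulnb mulnCA -fiber_at // big_distrr /=.
by apply: eq_bigr => u _; rewrite mulnb.
Qed.

Lemma fiber_card (x : input 2) : x \in hard0 2 -> #|psi_fiber x| = 16.
Proof.
(* Four leaves are targets: two in each of the two children of value 0. *)
move=> hx; rewrite -sum1_card (fiber_sum xpredT hx) (_ : \sum_l _ = 4) //.
move: hx; rewrite inE hard_top maj3_top => /andP[/andP[/forallP hx]].
rewrite hard_bits maj3_bits sum_leaf => ht m0.
have E j : \sum_(q < 3 ^ 1) target false x (leaf j q) = 2 * ~~ top x j.
  have xE q : x (leaf j q) = child x j q by rewrite ffunE.
  rewrite [LHS](@big_ord3 _ 0 addn) /target !parent_leaf !xE [top x j]ffunE.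
  move: (hx j); rewrite maj3_bits hard_bits.
  by case: (child x j o0) (child x j o1) (child x j o2) => [] [] [].
rewrite (eq_bigr _ (fun j _ => E j)) big_ord3 /=; move: ht m0.
by case: (top x o0) (top x o1) (top x o2) => [] [] [].
Qed.

(** * The absolute minority *)

Lemma minority_unique (t : input 1) j j' : hard t -> t j != maj3 t ->
  (t j' != maj3 t) = (j' == j).
Proof.
rewrite hard_bits maj3_bits.
by case: (ord3P j) (ord3P j') => -> [] -> /=;
  case: (t o0) (t o1) (t o2) => [] [] [].
Qed.

(** Hardness rules out that all children share the root's value, so the default in [abs_min] is
    never reached. *)
Lemma abs_minE k (x : input k.+1) : hard x ->
  exists2 j, maj3 (child x j) != maj3 x & abs_min x = leaf j (abs_min (child x j)).
Proof.
rewrite hard_top => /andP[_ ht] /=; case: pickP => [j mj|none] /=; first by exists j.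
have E j : top x j = maj3 (top x).
  by rewrite -[RHS]maj3_top; apply/eqP/negbFE; rewrite ffunE; apply: none.
by move: ht; rewrite hard_bits !E eqxx.
Qed.

(** From a root of value 0 the minority path enters the only child of value 1, then its only leaf of
    value 0. *)
Lemma abs_min_target (x : input 2) l : x \in hard0 2 ->
  (abs_min x == l) = target true x l.
Proof.
rewrite inE => /andP[hx m0]; have [j mj ->] := abs_minE hx.
move: hx; rewrite hard_top => /andP[/forallP hx ht].
have [q mq ->] := abs_minE (hx j).
rewrite maj3_leaf1 in mq; rewrite -[in LHS](leafP l) leaf_eqE leaf1 /target.
have topE i : top x i = maj3 (child x i) by rewrite ffunE.
rewrite -topE maj3_top in mj; rewrite -topE eqb_id.
have m1 := minority_unique (parent l) ht mj; rewrite -maj3_top (negPf m0) in m1 mj.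
rewrite eqbF_neg negbK in m1; rewrite m1 andbC.
have [jl|] /= := eqVneq (parent l) j; last by rewrite !andbF.
rewrite !andbT; have := minority_unique (digit l) (hx j) mq.
rewrite -topE; have -> : top x j by move: mj; rewrite eqbF_neg negbK.
by rewrite eqb_id -jl ffunE leafP eq_sym.
Qed.

(** * Counting visited leaves relative to a partial assignment *)

Definition partial := 'I_(3 ^ 2) -> option bool.

Definition agrees (p : partial) (x : input 2) : bool :=
  [forall l, (p l == None) || (p l == Some (x l))].

Definition fill (p : partial) (i : 'I_(3 ^ 2)) (b : bool) : partial :=
  fun l => if l == i then Some b else p l.

Lemma agrees_fill p i b x : p i = None ->
  agrees (fill p i b) x = agrees p x && (x i == b).
Proof.
move=> pi; apply/forallP/andP => [H|[/forallP H /eqP <-] l]; last first.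
  by rewrite /fill; have [->|_] := eqVneq l i; [rewrite eqxx orbT|apply: H].
split; last by have := H i; rewrite /fill eqxx /= => /eqP [->].
by apply/forallP => l; have := H l; rewrite /fill; case: (eqVneq l i) => // ->; rewrite pi.
Qed.

Definition visits v p (C : dtree (3 ^ 2)) : nat :=
  \sum_(x in hard0 2 | agrees p x)
    \sum_(l | p l == None) ((l \in queries C x) && target v x l).

(** Applied once [i] has been filled with 0: then it counts the inputs for which [i] is a target. *)
Definition reward v p (i : 'I_(3 ^ 2)) : nat :=
  \sum_(x in hard0 2 | agrees p x) (maj3 (child x (parent i)) == v).

Lemma visits_known v p i t0 t1 b : p i = Some b ->
  visits v p (Query i t0 t1) = visits v p (if b then t1 else t0).
Proof.
move=> pi; apply: eq_bigr => x /andP[_ /forallP/(_ i)].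
rewrite pi /= => /eqP [->]; apply: eq_bigr => l /eqP pl.
by rewrite inE; have [li|_] := eqVneq l i; [rewrite li pi in pl|case: (x i)].
Qed.

(** A leaf answered 1 is never a target, so only the 0 branch yields a reward. *)
Lemma visits_new v p i t0 t1 : p i = None ->
  visits v p (Query i t0 t1)
    = reward v (fill p i false) i
      + (visits v (fill p i false) t0 + visits v (fill p i true) t1).
Proof.
move=> pi.
have E x :
    \sum_(l | p l == None) ((l \in queries (Query i t0 t1) x) && target v x l)
  = target v x i + \sum_(l | fill p i (x i) l == None)
      ((l \in queries (if x i then t1 else t0) x) && target v x l).
  rewrite (bigD1 i) ?pi //= inE eqxx; congr (_ + _).
  apply: eq_big => [l|l /andP[_ /negPf li]]; last by rewrite inE li.
  by rewrite /fill; case: (eqVneq l i); rewrite ?andbF ?andbT.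
rewrite /visits (eq_bigr _ (fun x _ => E x)).
rewrite (bigID (fun x : input 2 => x i)) /= addnC addnA; congr (_ + _).
  rewrite -big_split /=; apply: eq_big => [x|x /andP[_ /negPf xi]].
    by rewrite agrees_fill // eqbF_neg andbA.
  by rewrite xi /target xi.
apply: eq_big => [x|x /andP[_ xi]]; first by rewrite agrees_fill // eqb_id andbA.
by rewrite xi /target xi.
Qed.

(** * From partial assignments to numbers of bits found *)

(* Only the numbers of leaves of each child that were found to be 0 and to be 1
   matter. *)
Definition found p (j : 'I_3) (b : bool) : nat :=
  (p (@leaf 1 j o0) == Some b) + (p (@leaf 1 j o1) == Some b)
  + (p (@leaf 1 j o2) == Some b).

Definition state p : seq (nat * nat) :=
  [seq (found p j false, found p j true) | j <- [:: o0; o1; o2]].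

(** Exactly one entry of a hard triple of majority [v] differs from [v]: either it was found and the
    rest is forced, or it is any of the [3 - same] unread leaves. *)
Definition completions (v : bool) (s : nat * nat) : nat :=
  let: (same, other) := if v then (s.2, s.1) else s in
  if other == 0 then 3 - same else other == 1.

(** Counts the inputs of value 0 whose minority child is [m]; see [weightE]. *)
Definition weight (m : nat) (st : seq (nat * nat)) : nat :=
  completions (0 == m) (nth (0, 0) st 0)
  * (completions (1 == m) (nth (0, 0) st 1)
     * completions (2 == m) (nth (0, 0) st 2)).

Definition gain (v : bool) (j : nat) (st : seq (nat * nat)) : nat :=
  sumn [seq weight m st | m <- [:: 0; 1; 2] & (m == j) == v].

Definition agrees1 p j (t : input 1) : bool :=
  [forall q, (p (leaf j q) == None) || (p (leaf j q) == Some (t q))].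

Lemma sum_input1 (F : bool -> bool -> bool -> nat) :
  \sum_(t : input 1) F (t o0) (t o1) (t o2)
    = \sum_(a : bool) \sum_(b : bool) \sum_(c : bool) F a b c.
Proof.
pose h (w : bool * (bool * bool)) : input 1 :=
  [ffun q : 'I_3 => nth false [:: w.1; w.2.1; w.2.2] q].
rewrite (reindex h) /=; last first.
  exists (fun t : input 1 => (t o0, (t o1, t o2))) => [[a [b c]] _|t _].
    by rewrite /h !ffunE.
  by apply/ffunP => q; case: (ord3P q) => ->; rewrite ffunE.
rewrite (eq_bigr (fun w => F w.1 w.2.1 w.2.2)); last first.
  by move=> w _; rewrite !ffunE.
rewrite -(pair_big xpredT xpredT (fun a w => F a w.1 w.2)) /=.
apply: eq_bigr => a _.
by rewrite -(pair_big xpredT xpredT (fun b c => F a b c)).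
Qed.

Lemma completionsE v p j :
  \sum_(t : input 1) [&& agrees1 p j t, hard t & maj3 t == v]
    = completions v (found p j false, found p j true).
Proof.
pose F a b c : nat :=
  [&& [&& (p (@leaf 1 j o0) == None) || (p (@leaf 1 j o0) == Some a),
          (p (@leaf 1 j o1) == None) || (p (@leaf 1 j o1) == Some b)
        & (p (@leaf 1 j o2) == None) || (p (@leaf 1 j o2) == Some c)],
      ~~ ((a == b) && (b == c)) & (1 < a + b + c) == v].
rewrite (eq_bigr (fun t : input 1 => F (t o0) (t o1) (t o2))); last first.
  by move=> t _; rewrite /agrees1 forall_ord3 hard_bits maj3_bits.
rewrite sum_input1 !big_bool /F /found {F}.
by case: (p _) (p _) (p _) v => [[]|] [[]|] [[]|] [].
Qed.

Lemma sum_children (F : {ffun 'I_3 -> input 1} -> nat) :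
  \sum_(x : input 2) F [ffun j => child x j] = \sum_t F t.
Proof.
rewrite [RHS](reindex (fun x : input 2 => [ffun j => child x j])) //=.
exists (fun t : {ffun 'I_3 -> input 1} => [ffun l => t (@parent 1 l) (digit l)] : input 2).
  by move=> x _; apply/ffunP => l; rewrite !ffunE leafP.
move=> t _; apply/ffunP => j; apply/ffunP => q.
by rewrite !ffunE parent_leaf digit_leaf.
Qed.

Lemma agrees_child p x : agrees p x = [forall j, agrees1 p j (child x j)].
Proof.
apply/forallP/forallP => H => [j|l].
  by apply/forallP => q; rewrite ffunE; apply: H.
by have /forallP/(_ (digit l)) := H (parent l); rewrite ffunE leafP.
Qed.

(** Once the minority child is fixed, each child has a prescribed majority and the children vary
    independently, so the count factors. *)
Lemma weightE p (m : 'I_3) :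
  \sum_(x in hard0 2 | agrees p x) maj3 (child x m) = weight m (state p).
Proof.
pose G j (t : input 1) : nat := [&& agrees1 p j t, hard t & maj3 t == (j == m)].
transitivity (\sum_(x : input 2) \prod_(j < 3) G j ([ffun j => child x j] j)).
  rewrite big_mkcond; apply: eq_bigr => x _.
  rewrite prod_ord3 /G !ffunE !mulnb.
  rewrite -[X in if X then _ else _]/((x \in hard0 2) && agrees p x).
  rewrite inE hard_top maj3_top hard_bits maj3_bits agrees_child !forall_ord3 -!top_bit.
  move: (agrees1 _ _ _) (agrees1 _ _ _) (agrees1 _ _ _) => [] [] [];
  move: (hard _) (hard _) (hard _) => [] [] []; rewrite ?andbF //=.
  by case: (ord3P m) => -> /=; case: (top x o0) (top x o1) (top x o2) => [] [] [].
rewrite (sum_children (fun t => \prod_(j < 3) G j (t j))).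
rewrite -(bigA_distr_bigA G) (eq_bigr _ (fun j _ => completionsE (j == m) p j)).
by rewrite prod_ord3.
Qed.

(** Exactly one child has value 1; hence child [j] has value 0 when the 1 occurs among the
    others. *)
Lemma minority_child v (j : 'I_3) x : x \in hard0 2 ->
  (top x j == v) = \sum_(m < 3 | (m == j) == v) top x m :> nat.
Proof.
rewrite inE hard_top maj3_top hard_bits maj3_bits => /andP[/andP[_]].
rewrite big_mkcond sum_ord3; case: (ord3P j) => ->;
  by case: (top x o0) (top x o1) (top x o2) v => [] [] [] [].
Qed.

Lemma rewardE v p i : reward v p i = gain v (parent i) (state p).
Proof.
transitivity (\sum_(m < 3 | (m == parent i) == v) weight m (state p)).
  under [RHS]eq_bigr => m _ do rewrite -weightE.
  rewrite [RHS]exchange_big; apply: eq_bigr => x /andP[hx _].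
  rewrite -top_bit minority_child //.
  by apply: eq_bigr => m _; rewrite top_bit.
rewrite big_mkcond sum_ord3 /gain; move: (weight) => w.
by case: (ord3P (parent i)) => ->; case: v; rewrite /= ?addn0.
Qed.

(** * The potential inequality *)

Definition update (b : bool) (j : nat) (st : seq (nat * nat)) : seq (nat * nat) :=
  let s := nth (0, 0) st j in
  set_nth (0, 0) st j (if b then (s.1, s.2.+1) else (s.1.+1, s.2)).

Lemma state_fill p i b : p i = None ->
  state (fill p i b) = update b (parent i) (state p).
Proof.
rewrite -(leafP i) parent_leaf; move: (parent i) (digit i) => j q.
rewrite /state /found /fill /= !leaf_eqE.
case: (ord3P j) (ord3P q) => -> [] -> /= ->;
  by case: b; rewrite /update /= ?addn0 ?add0n ?addn1 ?add1n ?addnS ?addSn.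
Qed.

Definition partials : seq (nat * nat) :=
  [seq (a, b) | a <- iota 0 4, b <- iota 0 (4 - a)].

Lemma found_partials p j : (found p j false, found p j true) \in partials.
Proof. by rewrite /found; do 3!case: (p _) => [[]|]. Qed.

Lemma found_room p i : p i = None ->
  found p (parent i) false + found p (parent i) true < 3.
Proof.
rewrite -(leafP i) parent_leaf; move: (parent i) (digit i) => j q.
rewrite /found; case: (ord3P q) => -> ->; by do 2!case: (p _) => [[]|].
Qed.

(* A child is settled once a 0 has been found in it, which may have been the
   absolute minority, or once two 1s show that it is the minority child. *)
Definition settled (s : nat * nat) : bool := (0 < s.1) || (1 < s.2).

(* Once some child is settled, read on in each settled child until it shows two
   equal bits, and also read the two other children if this reveals the minority
   child. No absolute minority is met that was not met before. [potential] is 7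
   times the number of absolute majority leaves that are still collected. The
   four values without a settled child come from backward induction, indexed by
   the number of children in which a single 1 was found. *)
Definition potential (st : seq (nat * nat)) : nat :=
  let s j := nth (0, 0) st j in
  if has settled st then
    7 * sumn [seq weight m st
                * sumn [seq 2 - (s j).1 | j <- [:: 0; 1; 2] &
                          (j != m) && (settled (s m) || settled (s j))]
             | m <- [:: 0; 1; 2]]
  else nth 0 [:: 0; 108; 60; 16] (count_mem (0, 1) st).

(** The premise leaves an unread leaf in child [j]; only the 0 branch carries gains. The term with
    96 stands on the right to avoid truncated subtraction. *)
Definition potential_step st j : bool :=
  let s := nth (0, 0) st j in
  (s.1 + s.2 < 3) ==>
  (7 * gain false j (update false j st)
     + (potential (update false j st) + potential (update true j st))
   <= 96 * gain true j (update false j st) + potential st).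

Lemma potential_stepP :
  all (fun s0 => all (fun s1 => all (fun s2 =>
    all (potential_step [:: s0; s1; s2]) (iota 0 3)) partials) partials) partials.
Proof. by vm_compute. Qed.

Lemma potential_step_state p i : p i = None ->
  7 * reward false (fill p i false) i
    + (potential (state (fill p i false)) + potential (state (fill p i true)))
  <= 96 * reward true (fill p i false) i + potential (state p).
Proof.
move=> pi; rewrite !rewardE !state_fill //; move: (found_room pi).
have /allP/(_ _ (found_partials p o0)) := potential_stepP.
move=> /allP/(_ _ (found_partials p o1)) /allP/(_ _ (found_partials p o2)).
rewrite -/(state p) => /allP/(_ (parent i : nat)).
rewrite mem_iota (ltn_ord (parent i)) => /(_ isT) /implyP step room; apply: step.
by move: room; rewrite /state; case: (ord3P (parent i)) => ->.
Qed.

Lemma visits_bound (C : dtree (3 ^ 2)) p :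
  7 * visits false p C <= 96 * visits true p C + potential (state p).
Proof.
elim: C p => [b|i t0 IH0 t1 IH1] p.
  rewrite /visits big1 // => x _; by rewrite big1.
case pi: (p i) => [b|].
  by rewrite !(visits_known _ _ _ pi); case: b pi => _; [apply: IH1|apply: IH0].
rewrite !visits_new //; have := potential_step_state pi.
move: (IH0 (fill p i false)) (IH1 (fill p i true)).
by move: (potential _) (potential _) (potential _) => P0 P1 P; lia.
Qed.

(** A form of [visits] without sums over inputs, so that a concrete tree can be evaluated by
    computation. *)
Fixpoint value v p (C : dtree (3 ^ 2)) : nat :=
  match C with
  | Answer _ => 0
  | Query i t0 t1 =>
      if p i is Some b then value v p (if b then t1 else t0) else
      gain v (parent i) (state (fill p i false))
      + (value v (fill p i false) t0 + value v (fill p i true) t1)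
  end.

Lemma visitsE v p C : visits v p C = value v p C.
Proof.
elim: C p => [b|i t0 IH0 t1 IH1] p.
  by rewrite /visits big1 // => x _; rewrite big1.
rewrite [RHS]/=; case pi: (p i) => [[]|].
- by rewrite (visits_known _ _ _ pi) IH1.
- by rewrite (visits_known _ _ _ pi) IH0.
by rewrite visits_new // rewardE IH0 IH1.
Qed.

(** * The ratio as a quotient of visit counts *)

Definition unknown : partial := fun _ => None.

Lemma agrees_unknown x : agrees unknown x.
Proof. by apply/forallP. Qed.

Lemma hard0_neq0 : #|hard0 2| != 0.
Proof.
(* The weight at the empty assignment is 27, as each child has three completions. *)
apply/eqP => /card0_eq none; have := weightE unknown o0.
by rewrite big1 // => x; rewrite none.
Qed.

Local Open Scope ring_scope.

(** Each visited target accounts for 4 of the 16 points of the fiber. *)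
Lemma Pr_fiber (C : dtree (3 ^ 2)) x : x \in hard0 2 ->
  Pr (psi_fiber x) (fun u => @q1 2 u.2 \in queries C x)
    = (\sum_l ((l \in queries C x) && target false x l))%:R / 4%:R.
Proof.
move=> hx; rewrite /Pr /avg fiber_card // -natr_sum.
rewrite (fiber_sum (fun l => l \in queries C x)) // natrM.
by rewrite (_ : 16 = 4 * 4)%N // natrM invfM mulrACA divff // mul1r.
Qed.

Lemma hits_min (C : dtree (3 ^ 2)) x : x \in hard0 2 ->
  (abs_min x \in queries C x : nat)
    = (\sum_l ((l \in queries C x) && target true x l))%N.
Proof.
move=> hx; have := abs_min_target (abs_min x) hx; rewrite eqxx => min_hit.
rewrite (bigD1 (abs_min x)) // -min_hit andbT big1 => [|l]; first exact/esym/addn0.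
by rewrite -abs_min_target // [l == _]eq_sym => /negPf ->; rewrite andbF.
Qed.

Lemma sum_visits v (C : dtree (3 ^ 2)) :
  (\sum_(x in hard0 2) \sum_l ((l \in queries C x) && target v x l))%N
    = visits v unknown C.
Proof.
by apply: eq_bigl => x; rewrite agrees_unknown andbT.
Qed.

Lemma alpha_visits (C : dtree (3 ^ 2)) :
  @alpha_tree 2 C
    = (visits false unknown C)%:R / (4 * visits true unknown C)%:R.
Proof.
rewrite /alpha_tree {1}/avg (eq_bigr _ (@Pr_fiber C)) -mulr_suml -natr_sum.
rewrite {1}/Pr {1}/avg -natr_sum (eq_bigr _ (@hits_min C)) !sum_visits natrM.
have h0 : (#|hard0 2|%:R : rat) != 0 by rewrite pnatr_eq0 hard0_neq0.
by rewrite !invfM invrK [RHS]mulrA -!mulrA; congr (_ * (_ * _)); rewrite mulrCA mulVf ?mulr1.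
Qed.

(** * A tree attaining the bound *)

Definition lf (j q : 'I_3) : 'I_(3 ^ 2) := @leaf 1 j q.

Fixpoint read_all n (s : seq 'I_n) : dtree n :=
  if s is i :: s' then Query i (read_all s') (read_all s') else Answer n false.

Definition stop : dtree (3 ^ 2) := Answer _ false.

(** Leaves already read may be queried again; by [visits_known] this adds nothing to the counts. *)
Definition read_others (j : 'I_3) : dtree (3 ^ 2) :=
  read_all [seq lf i q | i <- rem j [:: o0; o1; o2], q <- [:: o0; o1; o2]].

Definition read_third j := Query (lf j o2) stop (read_others j).

Definition read_second j := Query (lf j o1) stop (read_third j).

(* Look for a 0, then read on in its child: another 0 there makes further
   queries too risky, while two 1s show that the absolute minority has been met
   already, so that the other two children can be read safely. *)
Definition best_tree : dtree (3 ^ 2) :=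
  Query (lf o0 o0) (read_second o0)
    (Query (lf o1 o0) (read_second o1)
      (Query (lf o2 o0) (read_second o2)
        (Query (lf o0 o1) (read_third o0) (read_others o0)))).

Lemma visits_best v : visits v unknown best_tree = if v then 14%N else 192%N.
Proof. by rewrite visitsE; case: v; vm_compute. Qed.

Lemma ratio_le (a b n d : nat) : (0 < d)%N -> (d * a <= n * b)%N ->
  a%:R / b%:R <= n%:R / d%:R :> rat.
Proof.
(* For [b = 0] the quotient on the left is 0 by convention. *)
move=> d0 ab; have [->|b0] := posnP b; first by rewrite invr0 mulr0 divr_ge0.
rewrite ler_pdivrMr ?ltr0n // mulrAC ler_pdivlMr ?ltr0n //.
by rewrite -!natrM ler_nat mulnC.
Qed.

Theorem theorem5 : is_alpha 2 (24%:R / 7%:R).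
Proof.
split=> [|C _]; first exists best_tree => //; rewrite alpha_visits.
  (* 192 / (4 * 14) = 24 / 7. *)
  by rewrite !visits_best.
(* The factor 96 of [visits_bound] is 24 * 4, with 4 from the denominator in [alpha_visits]. *)
apply: ratio_le => //; rewrite mulnA; have := visits_bound C unknown.
have -> : potential (state unknown) = 0%N by [].
by rewrite [X in (_ <= X)%N]addn0.
Qed.
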